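(* Let $S$ be a set of positive integers that is doubling-closed and productive, and let $q$ be a rational number with $0<q<\sum_{s\in S}\frac{1}{s}$ (where the sum is taken to be $+\infty$ if it diverges). Then $q$ has a representation as an Egyptian fraction with denominators in $S$; that is, there is a finite subset $D\subseteq S$ such that $q=\sum_{d\in D}\frac{1}{d}$.
   Context: A set $S$ of positive integers is \emph{doubling-closed} (closed under doubling) if for every $x\in S$, also $2x\in S$. It is \emph{productive} if for every positive integer $x$ there exists a positive integer $y$ such that $xy\in S$. An \emph{Egyptian fraction} is a representation of a rational number as a finite sum of distinct unit fractions $1/d$ with $d$ a positive integer; the unit fraction $1/1$ is allowed. *)

(* Defs.v *)
From mathcomp Require Import all_boot.
From mathcomp Require Import classical_sets.

Set Implicit Arguments.
Unset Strict Implicit.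
Unset Printing Implicit Defensive.

(* A set of positive integers is a [set nat] that does not contain 0; neither
   predicate below excludes 0 from S (indeed [set 0] is doubling-closed), so
   positivity is a separate hypothesis. *)
Definition doubling_closed (S : set nat) : Prop :=
  forall x : nat, S x -> S (2 * x).

Definition productive (S : set nat) : Prop :=
  forall x : nat, 0 < x -> exists2 y : nat, 0 < y & S (x * y).

(* Main.v *)
(* Let F(n) be the sum of 1/s over the s in S below n, and choose n with
   F(n) <= q < F(n+1); then n is in S and r = q - F(n) satisfies 0 <= r < 1/n.
   Productivity provides x = n N in S such that r = c / x, where c < N.
   Dividing c 2^N by N with quotient m and remainder p,
     r = (m / 2^N) / n + (p / 2^N) / x,   with m, p < 2^N,
   so the binary expansions of m / 2^N and p / 2^N write r as a sum of unit
   fractions with denominators n 2^i (i > 0) and x 2^j. These are all at least n,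
   and if 3 divides N then no n 2^i is equal to an x 2^j. *)
Require Import Defs.
From mathcomp Require Import all_boot all_order all_algebra finmap.
From mathcomp Require Import classical_sets reals ereal esum.
From mathcomp Require Import boolp filter sequences ereal_normedtype.
From mathcomp Require Import ring.

Set Implicit Arguments.
Unset Strict Implicit.
Unset Printing Implicit Defensive.

Import Order.TTheory GRing.Theory Num.Theory.

Local Open Scope classical_set_scope.
Local Open Scope ring_scope.

(** Induction on [k]: the expansion of [m./2] over [2 ^ k] is that of the even part of [m] over
    [2 ^ k.+1], and an odd [m] adds the digit [k.+1]. The bound [j <= k] keeps this digit new. *)
Lemma binary_fraction (k m : nat) : (m < 2 ^ k)%N ->
  exists J : seq nat, [/\ uniq J, {in J, forall j, 0 < j <= k}%N &
    m%:R / 2 ^+ k = \sum_(j <- J) (2 ^+ j)^-1 :> rat].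
Proof.
elim: k m => [|k IHk] m ltm.
  by exists [::]; split=> //; rewrite big_nil; case: m ltm => // _; rewrite mul0r.
have [|J [uJ J_le sumJ]] := IHk m./2.
  by rewrite ltn_half_double -muln2 mulnC -expnS.
have half_eq : m./2%:R / 2 ^+ k = m./2.*2%:R / 2 ^+ k.+1 :> rat.
  rewrite -muln2 natrM exprS; field.
  by rewrite expf_neq0.
have JS : {in J, forall j, 0 < j <= k.+1}%N.
  by move=> j /J_le /andP[-> /leqW].
rewrite -(odd_double_half m); case: (odd m); last first.
  by exists J; split=> //; rewrite add0n -half_eq.
exists (k.+1 :: J); split.
- by rewrite /= uJ andbT; apply/negP => /J_le; rewrite ltnn andbF.
- by move=> j; rewrite inE => /predU1P[-> | /JS //]; rewrite leqnn.
- by rewrite big_cons -sumJ half_eq natrD mulrDl mul1r.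
Qed.

Lemma doubling_closed_pow2 (S : set nat) (x i : nat) :
  doubling_closed S -> S x -> S (2 ^ i * x)%N.
Proof.
move=> S_dbl Sx; elim: i => [|i IHi]; first by rewrite mul1n.
by rewrite expnS -mulnA; apply: S_dbl.
Qed.

Lemma sum_inv_pow2_mul (x : nat) (J : seq nat) :
  \sum_(d <- [seq (2 ^ j * x)%N | j <- J]) d%:R^-1 =
  (\sum_(j <- J) (2 ^+ j)^-1) / x%:R :> rat.
Proof.
rewrite big_map mulr_suml; apply: eq_bigr => j _.
by rewrite natrM natrX invfM.
Qed.

Lemma pow2_mul_inj (x : nat) : (0 < x)%N -> injective (fun j => 2 ^ j * x)%N.
Proof.
by move=> x_gt0 i j /eqP; rewrite eqn_pmul2r // eqn_exp2l // => /eqP.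
Qed.

(** If no partial sum exceeded [q], their limit would not either. From here on the argument can stay
    in [rat], whether or not the series converges. *)
Lemma lt_esum_partial_sum (R : realType) (S : set nat) (f : nat -> rat) (q : rat) :
    (forall n, 0 <= f n) ->
    ((ratr q : R)%:E < \esum_(s in S) (ratr (f s) : R)%:E)%E ->
  exists n, q < \sum_(0 <= s < n | s \in S) f s.
Proof.
move=> f_ge0; set F := (fun s => (ratr (f s) : R)%:E) => q_lt.
have F_ge0 n : (0 <= F n)%E by rewrite lee_fin ler0q.
apply/not_existsP => no_n; move: q_lt; apply/negP; rewrite -leNgt.
(* With a boolean predicate as index set, the sum becomes a limit of partial sums. *)
have -> : S = [set s | s \in S] by apply/seteqP; split=> s /=; rewrite inE.
rewrite -nneseries_esum => [|n _]; last exact: F_ge0.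
apply: lime_le; first by apply: is_cvg_nneseries_cond => n _ _; exact: F_ge0.
apply: nearW => n; rewrite sumEFin lee_fin -rmorph_sum ler_rat leNgt.
exact/negP/no_n.
Qed.

(** The product of [denq q] and [n!] is a common denominator, since each positive [s < n] divides
    [n!]. *)
Lemma sub_partial_sum_fraction (S : set nat) (q : rat) (n : nat) :
    (forall x : nat, S x -> (0 < x)%N) ->
    \sum_(0 <= s < n | s \in S) (s%:R : rat)^-1 <= q ->
  exists c L : nat, (0 < L)%N /\
    q - \sum_(0 <= s < n | s \in S) (s%:R : rat)^-1 = c%:R / L%:R.
Proof.
set F := \sum_(0 <= s < n | _) _ => S_pos F_le.
set L := (`|denq q| * n`!)%N.
have L_gt0 : (0 < L)%N by rewrite muln_gt0 absz_gt0 denq_neq0 fact_gt0.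
have qL : q * L%:R \is a Num.int.
  rewrite natrM mulrA rpredM ?rpred_nat // natr_absz ger0_norm ?denq_ge0 //.
  by rewrite -numqE rpred_int.
have FL : F * L%:R \is a Num.int.
  rewrite mulr_suml big_nat_cond; apply: rpred_sum => s /andP[/andP[_ lt_sn]].
  rewrite inE => /S_pos s_gt0; have /dvdnP[u ->] : (s %| L)%N.
    by rewrite dvdn_mull // dvdn_fact // s_gt0 ltnW.
  by rewrite natrM mulrCA mulVf ?mulr1 ?rpred_nat // pnatr_eq0 -lt0n.
have /natrP[c cE] : (q - F) * L%:R \is a Num.nat.
  by rewrite natrEint mulrBl rpredB // -mulrBl mulr_ge0 ?ler0n // subr_ge0.
by exists c, L; split=> //; rewrite -cE mulfK // pnatr_eq0 -lt0n.
Qed.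

Lemma two_chain_fraction (n N c : nat) : (0 < n)%N -> (c < N)%N ->
  exists I J : seq nat, [/\ uniq I, uniq J, {in I, forall i, 0 < i}%N &
    c%:R / (n * N)%:R =
      \sum_(d <- [seq (2 ^ i * n)%N | i <- I]) d%:R^-1 +
      \sum_(d <- [seq (2 ^ j * (n * N))%N | j <- J]) d%:R^-1 :> rat].
Proof.
move=> n_gt0 lt_cN; have N_gt0 : (0 < N)%N by apply: leq_ltn_trans lt_cN.
have lt_m : ((c * 2 ^ N) %/ N < 2 ^ N)%N.
  by rewrite ltn_divLR // mulnC ltn_pmul2l // expn_gt0.
(* The exponent [N] is large enough because [N < 2 ^ N]. *)
have lt_r : ((c * 2 ^ N) %% N < 2 ^ N)%N.
  exact: ltn_trans (ltn_pmod _ N_gt0) (ltn_expl _ _).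
have [I [uI I_gt0 sumI]] := binary_fraction lt_m.
have [J [uJ _ sumJ]] := binary_fraction lt_r.
exists I, J; split=> // [i /I_gt0 /andP[]//|].
rewrite !sum_inv_pow2_mul -sumI -sumJ.
have /(congr1 (fun m => m%:R : rat)) := divn_eq (c * 2 ^ N) N.
rewrite natrD !natrM natrX => divE.
have n_neq0 : n%:R != 0 :> rat by rewrite pnatr_eq0 -lt0n.
have N_neq0 : N%:R != 0 :> rat by rewrite pnatr_eq0 -lt0n.
have pow_neq0 : 2 ^+ N != 0 :> rat by rewrite expf_neq0.
(* Writing [c] as [c * 2 ^ N / 2 ^ N] lets the division identity enter. *)
rewrite -[c%:R](mulfK pow_neq0) divE; field.
by rewrite n_neq0 N_neq0 pow_neq0.
Qed.

Theorem theorem1 (R : realType) (S : set nat)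
    (S_pos : forall x : nat, S x -> (0 < x)%N)
    (S_dbl : doubling_closed S) (S_prod : productive S)
    (q : rat) (q_gt0 : 0 < q)
    (q_lt : ((ratr q : R)%:E < \esum_(s in S) ((s%:R : R)^-1)%:E)%E) :
  exists2 D : {fset nat}, [set` D] `<=` S &
    q = \sum_(d <- D) (d%:R : rat)^-1.
Proof.
pose F n : rat := \sum_(0 <= s < n | s \in S) s%:R^-1.
have exF : exists n, q < F n.
  apply: (@lt_esum_partial_sum R S (fun s => s%:R^-1)) => [n|].
    by rewrite invr_ge0 ler0n.
  rewrite (eq_esum (b := fun s => ((s%:R : R)^-1)%:E)) // => s _.
  by rewrite fmorphV rmorph_nat.
have [[|n] ltF minF] := ex_minnP exF.
  by move: ltF; rewrite /F big_nil ltNge ltW.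
have F_le : F n <= q by rewrite leNgt; apply/negP => /minF; rewrite ltnn.
(* The partial sum grows from [n] to [n.+1], which forces [n] into [S]. *)
move: ltF; rewrite /F big_mkcond big_nat_recr //= -big_mkcond -/(F n).
case: ifPn; last by rewrite addr0 ltNge F_le.
rewrite inE => Sn; have n_gt0 := S_pos _ Sn => ltF.
have [c [L [L_gt0 cE]]] := sub_partial_sum_fraction S_pos F_le.
(* The factor [L] clears the denominator of [q - F n]; the factor 3 will separate the two chains. *)
have [|y y_gt0 Sx] := S_prod (n * (3 * L))%N; first by rewrite !muln_gt0 n_gt0.
set N := (3 * L * y)%N; rewrite -mulnA -/N in Sx.
have N_gt0 : (0 < N)%N by rewrite !muln_gt0 L_gt0.
have n_neq0 : n%:R != 0 :> rat by rewrite pnatr_eq0 -lt0n.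
have L_neq0 : L%:R != 0 :> rat by rewrite pnatr_eq0 -lt0n.
have y_neq0 : y%:R != 0 :> rat by rewrite pnatr_eq0 -lt0n.
(* Since [n * N] is [L] times [n * 3 * y], this is the numerator of [c / L] over [n * N]. *)
set e := (c * (n * 3 * y))%N.
have eE : q - F n = e%:R / (n * N)%:R.
  rewrite cE /e /N !natrM; field.
  by rewrite n_neq0 L_neq0 y_neq0.
have lt_eN : (e < N)%N.
  have : q - F n < n%:R^-1 by rewrite ltrBlDl.
  rewrite eE natrM invfM mulrCA -[ltRHS]mulr1 ltr_pM2l ?invr_gt0 ?ltr0n //.
  by rewrite ltr_pdivrMr ?ltr0n // mul1r ltr_nat.
have [I [J [uI uJ I_gt0 IJE]]] := two_chain_fraction n_gt0 lt_eN.
pose A := [seq s <- index_iota 0 n | s \in S].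
pose B := [seq (2 ^ i * n)%N | i <- I].
pose C := [seq (2 ^ j * (n * N))%N | j <- J].
have lt_A s : s \in A -> (s < n)%N by rewrite mem_filter mem_index_iota => /and3P[].
have B_gt s : s \in B -> (n < s)%N.
  move=> /mapP[i /I_gt0 i_gt0 ->].
  by rewrite ltn_Pmull // (leq_ltn_trans i_gt0) // ltn_expl.
have C_ge s : s \in C -> (n <= s)%N.
  by move=> /mapP[j _ ->]; rewrite mulnCA leq_pmulr // muln_gt0 expn_gt0.
have uABC : uniq (A ++ B ++ C).
  have [uB uC] : uniq B /\ uniq C.
    by split; rewrite (map_inj_uniq (pow2_mul_inj _)) // muln_gt0 n_gt0.
  rewrite !cat_uniq filter_uniq ?iota_uniq // uB uC /= andbT.
  (* [A] lies below [n], while [B] and [C] do not. A common element of [B] and [C] would give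
     [2 ^ j * N = 2 ^ i], so 3 would divide a power of 2. *)
  apply/andP; split; apply/hasPn => s.
    rewrite mem_cat => /orP[/B_gt/ltnW|/C_ge] n_le_s;
      by apply/negP => /lt_A; rewrite ltnNge n_le_s.
  move=> /mapP[j _ ->]; apply/negP => /mapP[i _] /eqP.
  rewrite mulnCA mulnC eqn_pmul2r // => /eqP pow_eq.
  have : (3 %| 2 ^ i)%N by rewrite -pow_eq /N -!mulnA dvdn_mull // dvdn_mulr.
  by rewrite Euclid_dvdX.
exists [fset d in A ++ B ++ C]%fset.
  move=> d /=; rewrite in_fset /= !mem_cat => /or3P[|/mapP[i _ ->]|/mapP[j _ ->]].
  - by rewrite mem_filter => /andP[/set_mem].
  - exact: doubling_closed_pow2.
  - exact: doubling_closed_pow2.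
rewrite (perm_big (A ++ B ++ C)) /=; last first.
  by apply: uniq_perm => [|//|d]; rewrite ?fset_uniq ?in_fset.
by rewrite !big_cat /= big_filter -IJE -eE addrC subrK.
Qed.
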